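(* Let $A \in \mathbb{C}_{n,m}$, $D,E \in \mathbb{C}_{m,n}$, $r=\mathrm{rk}(D)$ and $s=\mathrm{rk}(E)$. If $\{ \mathbf{v}_1, \ldots, \mathbf{v}_r \}$ is a basis of $\mathcal{R}(D)$ and $\{ \mathbf{w}_1, \ldots, \mathbf{w}_{n-s} \}$ is a basis of $\mathcal{N}(E)$, then the following are equivalent: (i) $A^{\parallel (D,E)}$ exists. (ii) The matrix $[A \mathbf{v}_1 \ \cdots \ A \mathbf{v}_r \ \mathbf{w}_1 \ \cdots \ \mathbf{w}_{n-s}]$ is nonsingular (in particular, square). In this situation, $$A^{\parallel (D,E)} = \left[ \mathbf{v}_1 \ \cdots \ \mathbf{v}_r \ \mathbf{0} \ \cdots \ \mathbf{0} \right]\left[A \mathbf{v}_1 \ \cdots \ A \mathbf{v}_r \ \mathbf{w}_1 \ \cdots \ \mathbf{w}_{n-s}\right]^{-1},$$ where the first factor is the $m\times n$ matrix whose last $n-s$ columns are zero.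
   Context: $\mathbb{C}_{m,n}$ is the set of $m\times n$ complex matrices ($m,n\in\mathbb{N}$); vectors are column vectors. For a matrix $M\in\mathbb{C}_{p,q}$, $\mathcal{R}(M)$ is its column space, $\mathcal{N}(M)=\{\mathbf{x}\in\mathbb{C}^q: M\mathbf{x}=\mathbf{0}\}$ its null space, and $\mathrm{rk}(M)$ its rank. For $A \in \mathbb{C}_{n,m}$ and $D,E \in \mathbb{C}_{m,n}$, $A$ is $(D,E)$-invertible if there exists $X\in\mathbb{C}_{m,n}$ such that $XAD=D$, $EAX=E$, $\mathcal{R}(X)\subseteq\mathcal{R}(D)$ and $\mathcal{N}(E)\subseteq\mathcal{N}(X)$. Such an $X$ is unique if it exists; it is called the $(D,E)$-inverse of $A$ and denoted $A^{\parallel (D,E)}$. *)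

(* Defs.v *)
From HB Require Import structures.
From mathcomp Require Import all_boot all_order all_algebra.
From mathcomp Require Import reals.
From mathcomp Require Import complex.

Set Implicit Arguments.
Unset Strict Implicit.
Unset Printing Implicit Defensive.

Import GRing.Theory.
Local Open Scope ring_scope.

(* MathComp's %MS row spaces are about rows; column vectors are wanted here,
   hence subspaces of 'cV. *)
Definition col_space (F : fieldType) (p q : nat) (M : 'M[F]_(p, q)) :
  {vspace 'cV[F]_p} := limg (linfun (fun x : 'cV[F]_q => M *m x)).

Definition null_space (F : fieldType) (p q : nat) (M : 'M[F]_(p, q)) :
  {vspace 'cV[F]_q} := lker (linfun (fun x : 'cV[F]_q => M *m x)).

Lemma col_spaceP (F : fieldType) (p q : nat) (M : 'M[F]_(p, q)) (y : 'cV[F]_p) :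
  reflect (exists x : 'cV[F]_q, y = M *m x) (y \in col_space M).
Proof.
apply: (iffP memv_imgP) => [[x _ ->]|[x ->]]; exists x;
  by rewrite ?memvf ?lfunE.
Qed.

Lemma null_spaceP (F : fieldType) (p q : nat) (M : 'M[F]_(p, q)) (x : 'cV[F]_q) :
  reflect (M *m x = 0) (x \in null_space M).
Proof. by rewrite memv_ker lfunE; apply: eqP. Qed.

Definition is_DE_inverse (F : fieldType) (m n : nat) (A : 'M[F]_(n, m))
    (D E : 'M[F]_(m, n)) (X : 'M[F]_(m, n)) : Prop :=
  [/\ X *m A *m D = D, E *m A *m X = E,
      (col_space X <= col_space D)%VS & (null_space E <= null_space X)%VS].

Definition DE_invertible (F : fieldType) (m n : nat) (A : 'M[F]_(n, m))
    (D E : 'M[F]_(m, n)) : Prop :=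
  exists X : 'M[F]_(m, n), is_DE_inverse A D E X.

(* This is what makes "the" (D,E)-inverse meaningful: is_DE_inverse A D E X
   reads X = A^{||(D,E)}. *)
Lemma DE_inverse_unique (F : fieldType) (m n : nat) (A : 'M[F]_(n, m))
    (D E X Y : 'M[F]_(m, n)) :
  is_DE_inverse A D E X -> is_DE_inverse A D E Y -> X = Y.
Proof.
case=> [XAD _ _ kX] [_ EAY rY _].
have colM p q k (M : 'M[F]_(p, q)) (N : 'M[F]_(q, k)) j :
    M *m col j N = col j (M *m N) by rewrite !colE mulmxA.
have eq_cols p q (M N : 'M[F]_(p, q)) :
    (forall j, col j M = col j N) -> M = N.
  by move=> MN; apply/matrixP => i j; have /matrixP/(_ i 0) := MN j; rewrite !mxE.
have XAY : X *m A *m Y = Y.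
  apply: eq_cols => j; rewrite -colM.
  have /col_spaceP[z ->] : col j Y \in col_space D.
    by apply: (subvP rY); apply/col_spaceP; exists (delta_mx j 0); rewrite colE.
  by rewrite mulmxA XAD.
suff: X *m (1%:M - A *m Y) = 0.
  by rewrite mulmxBr mulmx1 mulmxA XAY => /eqP; rewrite subr_eq0 => /eqP.
apply: eq_cols => j; rewrite -colM col0.
apply/null_spaceP/(subvP kX)/null_spaceP.
by rewrite colM mulmxBr mulmx1 mulmxA EAY subrr col0.
Qed.

Definition cols_mx (F : fieldType) (p q : nat) (u : q.-tuple 'cV[F]_p) :
  'M[F]_(p, q) := \matrix_(i < p, j < q) tnth u j i 0.

Definition nonsingular (F : fieldType) (p q : nat) (M : 'M[F]_(p, q)) : Prop :=
  exists e : q = p, castmx (erefl p, e) M \in unitmx.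

(* Main.v *)
Require Import Defs.
From HB Require Import structures.
From mathcomp Require Import all_boot all_order all_algebra.
From mathcomp Require Import reals.
From mathcomp Require Import complex.

Set Implicit Arguments.
Unset Strict Implicit.
Unset Printing Implicit Defensive.

Import GRing.Theory.
Local Open Scope ring_scope.

(** Write [V] and [W] for the matrices whose columns are the two bases, so that
    [M = [A V | W]] and [R(V) = R(D)], [R(W) = N(E)].  Every inclusion of column
    spaces is a factorization on the right ([col_space_subP]), so that the whole
    argument becomes matrix algebra.

    If [X] is the (D,E)-inverse, then [X A D = D] gives [X A V = V] and
    [N(E) <= N(X)] gives [X W = 0]; hence [X M = [V | 0]], which is the formula
    of the theorem as soon as [M] is invertible.  For the invertibility,
    [R(X) <= R(V)] gives [X = V Z], and [E (1 - A X) = 0] gives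
    [1 - A X = W U], so that [M [Z; U] = A X + (1 - A X) = 1].  On the other
    side, left inverses of [V] and [W] turn [X M = [V | 0]] into a left inverse
    of [M].

    Conversely, if [M] is invertible, then [X = [V | 0] M^-1] satisfies
    [X A V = V] and [X W = 0], which gives [X A D = D] and [N(E) <= N(X)];
    comparing [E A X M] with [E M] block by block gives [E A X = E]. *)

Lemma col_space_subP (F : fieldType) (p q k : nat)
    (M : 'M[F]_(p, q)) (N : 'M[F]_(p, k)) :
  (exists Z, N = M *m Z) <-> (col_space N <= col_space M)%VS.
Proof.
split=> [[Z ->]|/subvP sNM].
  apply/subvP => y /col_spaceP[x ->]; apply/col_spaceP.
  by exists (Z *m x); rewrite mulmxA.
have colN j : exists x, col j N == M *m x.
  have /col_spaceP[x ->] : col j N \in col_space M.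
    by apply/sNM/col_spaceP; exists (delta_mx j 0); rewrite colE.
  by exists x.
exists (\matrix_(i, j) xchoose (colN j) i 0); apply/matrixP => i j.
have /eqP/matrixP/(_ i 0) := xchooseP (colN j); rewrite !mxE => ->.
by apply: eq_bigr => l _; rewrite mxE.
Qed.

Lemma col_space_sub_null (F : fieldType) (p q k : nat)
    (E : 'M[F]_(p, q)) (N : 'M[F]_(q, k)) :
  (col_space N <= null_space E)%VS <-> E *m N = 0.
Proof.
split=> [/subvP sNE|EN0]; last first.
  by apply/subvP => y /col_spaceP[x ->]; apply/null_spaceP; rewrite mulmxA EN0 mul0mx.
apply/matrixP => i j; rewrite [RHS]mxE.
have /null_spaceP : col j N \in null_space E.
  by apply/sNE/col_spaceP; exists (delta_mx j 0); rewrite colE.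
by rewrite colE mulmxA -colE => /matrixP/(_ i 0); rewrite !mxE.
Qed.

Lemma mul_cols_mx (F : fieldType) (p q : nat) (u : q.-tuple 'cV[F]_p)
    (x : 'cV[F]_q) : cols_mx u *m x = \sum_j x j 0 *: tnth u j.
Proof.
apply/matrixP => i j; rewrite !mxE summxE ord1.
by apply: eq_bigr => l _; rewrite !mxE mulrC.
Qed.

Lemma col_space_cols_mx (F : fieldType) (p q : nat) (u : q.-tuple 'cV[F]_p) :
  col_space (cols_mx u) = <<u>>%VS.
Proof.
apply/eqP; rewrite eqEsubv; apply/andP; split; apply/subvP => y.
  case/col_spaceP => x ->; rewrite mul_cols_mx; apply: memv_suml => j _.
  by apply/memvZ/memv_span/mem_tnth.
move=> /coord_span {1}->; apply/col_spaceP; exists (\col_j coord u j y).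
by rewrite mul_cols_mx; apply: eq_bigr => j _; rewrite mxE (tnth_nth 0).
Qed.

(** The rows of the left inverse are the coordinate forms of the family. *)
Lemma free_cols_mx (F : fieldType) (p q : nat) (u : q.-tuple 'cV[F]_p) :
  free u -> exists L, L *m cols_mx u = 1%:M.
Proof.
move=> fu; exists (\matrix_(i, j) coord u i (delta_mx j 0)).
apply/matrixP => i j; rewrite !mxE eq_sym -(coord_free j i fu) -tnth_nth.
rewrite [X in coord u i X]matrix_sum_delta linear_sum; apply: eq_bigr => k _.
by rewrite big_ord1 linearZ !mxE mulrC.
Qed.

Lemma cols_mx_mull (F : fieldType) (p q k : nat) (A : 'M[F]_(p, q))
    (u : k.-tuple 'cV[F]_q) :
  cols_mx [tuple A *m tnth u j | j < k] = A *m cols_mx u.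
Proof.
apply/matrixP => i j; rewrite !mxE tnth_mktuple mxE.
by apply: eq_bigr => l _; rewrite mxE.
Qed.

(** Two one-sided inverses force a matrix to be square by comparing ranks, so
    that no equality of dimensions has to be carried along. *)
Lemma nonsingularP (F : fieldType) (p q : nat) (M : 'M[F]_(p, q)) :
  nonsingular M <-> exists K, M *m K = 1%:M /\ K *m M = 1%:M.
Proof.
split=> [[e]|[K [MK KM]]].
  by subst q; rewrite castmx_id => uM; exists (invmx M); rewrite mulmxV ?mulVmx.
have e : q = p by apply/eqP; rewrite eqn_leq (mulmx1_min MK) (mulmx1_min KM).
by exists e; subst q; rewrite castmx_id; case/mulmx1_unit: MK.
Qed.

Lemma nonsingular_solve (F : fieldType) (p q k : nat) (M : 'M[F]_(p, q))
    (X : 'M[F]_(k, p)) (B : 'M[F]_(k, q)) :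
  nonsingular M -> X *m M = B ->
  exists e : q = p,
    X = castmx (erefl k, e) B *m invmx (castmx (erefl p, e) M).
Proof.
case=> e uM <-; exists e; subst q; rewrite !castmx_id in uM *.
by rewrite mulmxK.
Qed.

Section BorderedMatrix.

Variables (F : fieldType) (m n r t : nat).
Variables (A : 'M[F]_(n, m)) (D E : 'M[F]_(m, n)).
Variables (V : 'M[F]_(m, r)) (W : 'M[F]_(n, t)).
Hypotheses (VD : col_space V = col_space D) (WE : col_space W = null_space E).

Lemma DE_inverse_mul_bordered (X : 'M[F]_(m, n)) :
  is_DE_inverse A D E X -> X *m row_mx (A *m V) W = row_mx V 0.
Proof.
case=> XAD _ _ kX; rewrite mul_mx_row mulmxA; congr row_mx; last first.
  by apply/col_space_sub_null; rewrite WE.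
have /col_space_subP[Q ->] : (col_space V <= col_space D)%VS by rewrite VD.
by rewrite mulmxA XAD.
Qed.

(** That [V] and [W] span makes [M K = 1] solvable; that their columns are
    independent, in the form of [LV] and [LW], makes [M] left invertible. *)
Lemma DE_inverse_nonsingular (X : 'M[F]_(m, n)) LV LW :
  LV *m V = 1%:M -> LW *m W = 1%:M ->
  is_DE_inverse A D E X -> nonsingular (row_mx (A *m V) W).
Proof.
move=> LVV LWW iX; have XM := DE_inverse_mul_bordered iX.
case: iX => _ EAX rX _.
have /col_space_subP[Z XZ] : (col_space X <= col_space V)%VS by rewrite VD.
have /col_space_subP[U WU] : (col_space (1%:M - A *m X) <= col_space W)%VS.
  by rewrite WE; apply/col_space_sub_null; rewrite mulmxBr mulmx1 mulmxA EAX subrr.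
set M := row_mx _ _ in XM *.
have MK : M *m col_mx Z U = 1%:M.
  by rewrite mul_row_col -mulmxA -XZ -WU addrC subrK.
(* From M (a, b) = y one reads off a = LV X y, then b = LW (y - A V a). *)
have KM : col_mx (LV *m X) (LW *m (1%:M - A *m V *m (LV *m X))) *m M = 1%:M.
  have LVXM : LV *m X *m M = row_mx 1%:M 0.
    by rewrite -mulmxA XM mul_mx_row LVV mulmx0.
  have restM : (1%:M - A *m V *m (LV *m X)) *m M = row_mx 0 W.
    rewrite mulmxBl mul1mx -(mulmxA (A *m V)) LVXM mul_mx_row mulmx1 mulmx0.
    by rewrite opp_row_mx add_row_mx subrr subr0.
  rewrite mul_col_mx LVXM -mulmxA restM mul_mx_row mulmx0 LWW.
  by rewrite [RHS]scalar_mx_block.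
apply/nonsingularP; exists (col_mx Z U); split=> //.
by rewrite -[col_mx Z U]mul1mx -KM -(mulmxA _ M) MK mulmx1.
Qed.

Lemma nonsingular_DE_invertible :
  nonsingular (row_mx (A *m V) W) -> DE_invertible A D E.
Proof.
move=> /nonsingularP[K [MK KM]]; set M := row_mx _ _ in MK KM.
pose X := row_mx V 0 *m K; exists X.
have XM : X *m M = row_mx V 0 by rewrite -mulmxA KM mulmx1.
have [XAV XW] : X *m A *m V = V /\ X *m W = 0.
  by apply: eq_row_mx; rewrite -XM mul_mx_row mulmxA.
have EW : E *m W = 0 by apply/col_space_sub_null; rewrite WE.
split.
- have /col_space_subP[P ->] : (col_space D <= col_space V)%VS by rewrite VD.
  by rewrite mulmxA XAV.
- have EM : E *m A *m X *m M = E *m M.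
    by rewrite -mulmxA XM !mul_mx_row EW mulmx0 mulmxA.
  by rewrite -[LHS]mulmx1 -[RHS]mulmx1 -MK !(mulmxA _ M) EM.
- rewrite -VD; apply/col_space_subP; exists (usubmx K).
  by rewrite /X -[K in LHS]vsubmxK mul_row_col mul0mx addr0.
- by rewrite -WE; apply/col_space_sub_null.
Qed.

End BorderedMatrix.

Theorem theorem9p1 (R : realType) (m n : nat) (A : 'M[R[i]]_(n, m))
    (D E : 'M[R[i]]_(m, n)) (r s : nat) (hr : r = \rank D) (hs : s = \rank E)
    (v : r.-tuple 'cV[R[i]]_m) (w : (n - s).-tuple 'cV[R[i]]_n)
    (hv : basis_of (col_space D) v) (hw : basis_of (null_space E) w) :
  let M : 'M[R[i]]_(n, r + (n - s)) :=
    row_mx (cols_mx [tuple A *m tnth v j | j < r]) (cols_mx w) in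
  (DE_invertible A D E <-> nonsingular M) /\
  (forall X : 'M[R[i]]_(m, n), is_DE_inverse A D E X ->
     exists e : (r + (n - s))%N = n,
       X = castmx (erefl m, e) (row_mx (cols_mx v) (0 : 'M[R[i]]_(m, n - s)))
           *m invmx (castmx (erefl n, e) M)).
Proof.
rewrite cols_mx_mull => M.
have VD : col_space (cols_mx v) = col_space D.
  by rewrite col_space_cols_mx (span_basis hv).
have WE : col_space (cols_mx w) = null_space E.
  by rewrite col_space_cols_mx (span_basis hw).
have [LV LVV] := free_cols_mx (basis_free hv).
have [LW LWW] := free_cols_mx (basis_free hw).
have nsM X : is_DE_inverse A D E X -> nonsingular M.
  exact: (DE_inverse_nonsingular VD WE LVV LWW).
split; first split=> [[X /nsM]|] //.
  exact: (nonsingular_DE_invertible VD WE).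
move=> X iX; apply: nonsingular_solve (nsM X iX) _.
exact: (DE_inverse_mul_bordered VD WE iX).
Qed.
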